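(* Let $\Sigma=(A,B,C,D)$ be a minimal system with $A\in\mathbb{R}^{n\times n}$, $B\in\mathbb{R}^{n\times m}$, $C\in\mathbb{R}^{m\times n}$, $D\in\mathbb{R}^{m\times m}$. If $\Sigma$ is reciprocal (with respect to $\sigma=I_m$) and signed time-reversible, then $\Sigma$ is cyclo-lossless. Conversely, if $\Sigma$ is cyclo-lossless with invertible storage matrix $Q$, and reciprocal (with respect to $\sigma=I_m$) with pseudo-inner product $G$, then $D=0$ and $Q=GQ^{-1}G$, and $\Sigma$ is signed time-reversible with signed time-reversibility map $R:=Q^{-1}G$.
   Context: The system $(A,B,C,D)$ is $\dot x=Ax+Bu$, $y=Cx+Du$, with transfer matrix $K(s)=C(sI-A)^{-1}B+D$; minimal means controllable and observable. Reciprocal with respect to $\sigma=I_m$ means $K(s)=K^\top(s)$. For a minimal system this is equivalent to the existence of a (unique) invertible $G=G^\top$ with $A^\top G=GA$, $B^\top G=C$, $D=D^\top$; this $G$ is called the pseudo-inner product of the reciprocal system. Signed time-reversible means $K(s)=-K(-s)$. A signed time-reversibility map is an invertible $R\in\mathbb{R}^{n\times n}$ with $RA=-AR$, $RB=B$, $C=CR$; for a signed time-reversible minimal system such $R$ is unique and satisfies $R^2=I$. Cyclo-lossless with storage matrix $Q$ means that there is a (possibly indefinite) $Q=Q^\top\in\mathbb{R}^{n\times n}$ with $\frac{d}{dt}\tfrac12x^\top Qx=y^\top u$ along all trajectories, equivalently $A^\top Q+QA=0$, $B^\top Q=C$, $D+D^\top=0$. *)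

(* Defs.v *)
From HB Require Import structures.
From mathcomp Require Import all_boot all_order all_algebra.
From mathcomp Require Import all_classical all_reals all_analysis.
Import numFieldNormedType.Exports.

Set Implicit Arguments.
Unset Strict Implicit.
Unset Printing Implicit Defensive.

Import Order.TTheory GRing.Theory Num.Theory.
Local Open Scope ring_scope.

(* A system  x' = A x + B u,  y = C x + D u  with n states, m inputs and
   m outputs is given by its four matrices. *)

Section Systems.
Variables (R : realType) (n m : nat).
Implicit Types (A : 'M[R]_n) (B : 'M[R]_(n, m)) (C : 'M[R]_(m, n)) (D : 'M[R]_m).

Definition controllable A B :=
  \rank (\mxrow_(k < n) (A ^+ k *m B)) = n.

Definition observable A C :=
  \rank (\mxcol_(k < n) (C *m A ^+ k)) = n.

Definition minimal A B C := controllable A B /\ observable A C.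

(* Transfer matrices have entries in the field of real rational functions;
   [constF] embeds the real numbers in it and [indet] is the variable s.
   [transfer A B C D z] is the rational matrix K(z), so that
   [transfer A B C D indet] is K(s) and [transfer A B C D (- indet)] is K(-s).
   The inverse is a genuine one: for z = s or z = -s, det (zI - A) is a nonzero
   polynomial, hence invertible as a rational function. *)
Definition constF (c : R) : {fraction {poly R}} := tofrac c%:P.

Definition indet : {fraction {poly R}} := tofrac 'X.

Definition transfer A B C D (z : {fraction {poly R}}) :
    'M[{fraction {poly R}}]_m :=
  map_mx constF C *m invmx (z%:M - map_mx constF A) *m map_mx constF B
    + map_mx constF D.

(* Reciprocity with respect to the signature sigma = I. *)
Definition reciprocal A B C D :=
  transfer A B C D indet = (transfer A B C D indet)^T.

Definition pseudo_inner_product A B C D (G : 'M[R]_n) :=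
  [/\ G \in unitmx, G^T = G, A^T *m G = G *m A, B^T *m G = C & D = D^T].

Definition signed_time_reversible A B C D :=
  transfer A B C D indet = - transfer A B C D (- indet).

Definition signed_time_reversibility_map A B C (T : 'M[R]_n) :=
  [/\ T \in unitmx, T *m A = - (A *m T), T *m B = B & C = C *m T].

(* No regularity is imposed on the input beyond the existence of the derivative
   of the state at every time. *)
Definition trajectory A B C D
    (u : R -> 'cV[R]_m) (x : R -> 'cV[R]_n) (y : R -> 'cV[R]_m) :=
  (forall t : R, is_derive t (1 : R) x (A *m x t + B *m u t)) /\
  (forall t, y t = C *m x t + D *m u t).

Definition stored_energy (Q : 'M[R]_n) (x : 'cV[R]_n) : R :=
  2^-1 * (x^T *m Q *m x) 0 0.

Definition supply (u y : 'cV[R]_m) : R := (y^T *m u) 0 0.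

(* Q is symmetric but possibly indefinite or singular. *)
Definition storage_matrix A B C D (Q : 'M[R]_n) :=
  Q^T = Q /\
  forall u x y, trajectory A B C D u x y ->
    forall t : R,
      is_derive t (1 : R) (fun tau => stored_energy Q (x tau))
        (supply (u t) (y t)).

Definition cyclo_lossless A B C D := exists Q, storage_matrix A B C D Q.

End Systems.

Arguments indet {R}.

(* Main.v *)
Require Import Defs.
From HB Require Import structures.
From mathcomp Require Import all_boot all_order all_algebra.
From mathcomp Require Import all_classical all_reals all_analysis.
From mathcomp Require Import zify.
Import numFieldNormedType.Exports.
Import Order.TTheory GRing.Theory Num.Theory.
Local Open Scope ring_scope.

Set Implicit Arguments.
Unset Strict Implicit.
Unset Printing Implicit Defensive.

(** Equal transfer matrices have equal feedthroughs and equal Markov parameters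
    C A^k B, since a strictly proper constant vanishes and
    s C (sI - A)^-1 B = C B + C A (sI - A)^-1 B.  Reciprocity and signed
    time-reversibility thus make C A^k B symmetric, and zero for odd k.  Then
    the columns of the matrices (-A^T)^k C^T satisfy the same linear relations
    as those of the matrices A^k B, and the map Q sending the latter to the
    former is the storage matrix; only controllability is used.
    Being a storage matrix amounts to the matrix equations
    A^T Q + Q A = 0, B^T Q = C, D + D^T = 0, because every pair (x(0), u(0))
    is the initial value of a trajectory with constant input.  Given these
    equations, T = Q^-1 G anticommutes with A and fixes B and C, so T^2 fixes
    every A^k B, whence T^2 = I. *)

(** * Controllability and the construction of the storage matrix *)

Lemma controllable_inj (R : realType) (n m : nat) (A : 'M[R]_n)
    (B : 'M[R]_(n, m)) (p : nat) (X Y : 'M[R]_(p, n)) :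
  controllable A B ->
  (forall k : 'I_n, X *m (A ^+ k *m B) = Y *m (A ^+ k *m B)) -> X = Y.
Proof.
move=> ctrl eqXY; apply: (@row_free_inj _ _ _ _ (\mxrow_(k < n) (A ^+ k *m B))).
  by rewrite -row_leq_rank ctrl.
by rewrite !mul_mxrow; apply: eq_mxrow.
Qed.

Lemma controllable_form_inj (R : realType) (n m : nat) (A : 'M[R]_n)
    (B : 'M[R]_(n, m)) (X Y : 'M[R]_n) :
  controllable A B ->
  (forall j k : 'I_n, (A ^+ j *m B)^T *m X *m (A ^+ k *m B)
                    = (A ^+ j *m B)^T *m Y *m (A ^+ k *m B)) -> X = Y.
Proof.
move=> ctrl eqXY; apply: trmx_inj; apply: (controllable_inj ctrl) => j.
apply: trmx_inj; rewrite !trmx_mul !trmxK -!trmx_mul.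
by apply: (controllable_inj ctrl) => k.
Qed.

(** Stacked over the indices, the hypothesis reads [U K = K^T V] with [K] the controllability
    matrix. A right inverse [W] of [K] gives [Q = W^T U]: then [Q K = (K W)^T V = V], and
    [K^T Q K = U K] yields [K^T Q = U] since [K] has full row rank. *)
Lemma exists_hankel_form (R : realType) (n m : nat) (A : 'M[R]_n)
    (B : 'M[R]_(n, m)) (U : 'I_n -> 'M[R]_(m, n)) (V : 'I_n -> 'M[R]_(n, m)) :
  controllable A B ->
  (forall j k : 'I_n, U j *m (A ^+ k *m B) = (A ^+ j *m B)^T *m V k) ->
  exists Q : 'M[R]_n,
    (forall j : 'I_n, (A ^+ j *m B)^T *m Q = U j) /\
    (forall k : 'I_n, Q *m (A ^+ k *m B) = V k).
Proof.
move=> ctrl hankel.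
pose K := \mxrow_(k < n) (A ^+ k *m B).
have /row_freeP[W KW] : row_free K by rewrite -row_leq_rank ctrl.
have KUV : \mxcol_(j < n) U j *m K = K^T *m \mxrow_(k < n) V k.
  rewrite tr_mxrow !mul_mxcol_mxrow; apply/eq_mxblockP => j k.
  exact: hankel.
have QK : (W^T *m \mxcol_(j < n) U j) *m K = \mxrow_(k < n) V k.
  by rewrite -mulmxA KUV mulmxA -trmx_mul KW trmx1 mul1mx.
exists (W^T *m \mxcol_(j < n) U j); split=> [j|k].
  have : K^T *m (W^T *m \mxcol_(j < n) U j) = \mxcol_(j < n) U j.
    apply: (row_free_inj (A := K)); first by rewrite -row_leq_rank ctrl.
    by rewrite -mulmxA QK KUV.
  by rewrite tr_mxrow mxcol_mul => /eq_mxcolP/(_ j).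
by move: QK; rewrite mul_mxrow => /eq_mxrowP/(_ k).
Qed.

Lemma signed_symmetric_markov_form (R : realType) (n m : nat) (A : 'M[R]_n)
    (B : 'M[R]_(n, m)) (C : 'M[R]_(m, n)) :
  controllable A B ->
  (forall k, C *m A ^+ k *m B = (C *m A ^+ k *m B)^T) ->
  (forall k, C *m A ^+ k *m B = (-1) ^+ k *: (C *m A ^+ k *m B)) ->
  exists Q : 'M[R]_n, [/\ Q^T = Q, A^T *m Q + Q *m A = 0 & B^T *m Q = C].
Proof.
move=> ctrl markov_sym markov_sign.
have trM k : (A ^+ k *m B)^T *m C^T = C *m A ^+ k *m B.
  by rewrite -trmx_mul mulmxA -markov_sym.
have splitM j k : (A ^+ (j + k) *m B)^T = (A ^+ j *m B)^T *m (A ^+ k)^T.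
  by rewrite -trmx_mul mulmxA addnC exprD mulmxE.
(* By [markov_sign], either [j + k] is even and the signs agree, or the Markov parameter
   vanishes. *)
have signM j k (i := (j + k)%N) :
    (-1) ^+ j *: (C *m A ^+ i *m B) = (-1) ^+ k *: (C *m A ^+ i *m B).
  rewrite [in LHS]markov_sign scalerA /i exprD mulrA -expr2 -exprM.
  by rewrite mulnC exprM sqrrN !expr1n mul1r.
(* The equations sought force [Q A^k B = (-A^T)^k C^T], which is [V k]; [U k] is its transpose. The
   index runs over all naturals because the equation for [A^T Q] below needs [hankel] at [k.+1],
   possibly equal to [n]. *)
pose U (j : nat) := (-1) ^+ j *: (C *m A ^+ j).
pose V (k : nat) := (-1) ^+ k *: ((A ^+ k)^T *m C^T).
have hankel j k : U j *m (A ^+ k *m B) = (A ^+ j *m B)^T *m V k.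
  rewrite /U /V -scalemxAl -scalemxAr (mulmxA _ _ C^T) -splitM trM -signM.
  by rewrite exprD -mulmxE !mulmxA.
have [Q [UQ VQ]] := exists_hankel_form (U := U) (V := V) ctrl
  (fun j k => hankel j k).
have Qsym : Q^T = Q.
  apply: (controllable_form_inj ctrl) => j k; rewrite UQ.
  by rewrite -trmx_mul VQ /V linearZ /= trmx_mul !trmxK.
(* [UQ] at index 0 would give this only for positive [n], so it is tested on the columns of
   [A^k B]. *)
have BQ : B^T *m Q = C.
  apply: (controllable_inj ctrl) => k; rewrite -mulmxA VQ /V -scalemxAr.
  by rewrite !mulmxA -trmx_mul trM -markov_sign.
have VS k : V k.+1 = - (A^T *m V k).
  by rewrite /V exprS mulN1r scaleNr -scalemxAr exprSr -mulmxE trmx_mul mulmxA.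
exists Q; split=> //; apply/eqP; rewrite addr_eq0; apply/eqP.
apply: (controllable_form_inj ctrl) => j k.
have -> : (A ^+ j *m B)^T *m (A^T *m Q) *m (A ^+ k *m B)
        = (A ^+ j *m B)^T *m (A^T *m V k) by rewrite -VQ !mulmxA.
rewrite mulmxN mulNmx (mulmxA _ Q) UQ -mulmxA (mulmxA A) -[A *m _]/(A * _).
by rewrite -exprS hankel VS mulmxN opprK.
Qed.

(** * Strictly proper rational functions and degree bounds *)

Section StrictlyProper.
Variable F : idomainType.
Implicit Types f g : {fraction {poly F}}.

(** The fraction need not be reduced, so sums can keep the product denominator. *)
Definition strictly_proper f :=
  exists p q : {poly F},
    [/\ q != 0, (size p < size q)%N & f = tofrac p / tofrac q].

Lemma strictly_proper0 : strictly_proper 0.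
Proof.
by exists 0, 1; rewrite oner_neq0 size_poly0 size_poly1 tofrac0 mul0r.
Qed.

Lemma strictly_properD f g :
  strictly_proper f -> strictly_proper g -> strictly_proper (f + g).
Proof.
move=> [p [q [q0 pq ->]]] [p' [q' [q'0 pq' ->]]].
exists (p * q' + p' * q), (q * q'); split.
- by rewrite mulf_neq0.
- have sq : (0 < size q)%N by rewrite size_poly_gt0.
  have sq' : (0 < size q')%N by rewrite size_poly_gt0.
  apply: leq_ltn_trans (size_polyD _ _) _; rewrite (size_mul q0 q'0) gtn_max.
  by apply/andP; split; apply: leq_ltn_trans (size_polyMleq _ _) _; lia.
- by rewrite tofracD !tofracM addf_div ?tofrac_eq0.
Qed.

Lemma strictly_properZ (c : F) f :
  strictly_proper f -> strictly_proper (tofrac c%:P * f).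
Proof.
move=> [p [q [q0 pq ->]]]; exists (c *: p), q; split=> //.
  by apply: leq_ltn_trans pq; apply: size_scale_leq.
by rewrite mulrA -tofracM mul_polyC.
Qed.

Lemma strictly_proper_sum (I : Type) (r : seq I)
    (E : I -> {fraction {poly F}}) :
  (forall i, strictly_proper (E i)) -> strictly_proper (\sum_(i <- r) E i).
Proof.
move=> HE; apply: (big_ind strictly_proper) => //.
- exact: strictly_proper0.
- exact: strictly_properD.
Qed.

(** Clearing denominators gives [c q = p], and a nonzero [c] would force equal degrees. *)
Lemma strictly_proper_const (c : F) : strictly_proper (tofrac c%:P) -> c = 0.
Proof.
move=> [p [q [q0 pq /eqP]]]; rewrite -[tofrac c%:P]divr1 -tofrac1.
rewrite eqr_div ?tofrac_eq0 ?oner_neq0 // -!tofracM tofrac_eq mulr1 => /eqP eqp.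
apply/eqP/negP => /negP c0; move: pq.
by rewrite -eqp mul_polyC size_scale // ltnn.
Qed.

End StrictlyProper.

Lemma size_det_leq (F : idomainType) n (M : 'M[{poly F}]_n) :
  (forall i j, (size (M i j) <= 2)%N) -> (size (\det M) <= n.+1)%N.
Proof.
move=> szM; apply: (leq_trans (size_sum _ _ _)); apply/bigmax_leqP => s _.
rewrite mulr_sign; set d := \prod_i _.
have -> : size (if perm.odd_perm s then - d else d) = size d.
  by case: ifP; rewrite ?size_polyN.
rewrite {}/d; apply: (leq_trans (size_poly_prod_leq _ _)).
rewrite cardT size_enum_ord leq_subLR addnS ltnS.
apply: (@leq_trans (\sum_(i < n) 2)); first exact: leq_sum.
by rewrite sum_nat_const card_ord muln2 addnn.
Qed.

(** A cofactor is a minor of order [n - 1] with entries of degree at most 1. The bound [n] lies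
    below the size [n + 1] of the characteristic polynomial, which makes the resolvent strictly
    proper. *)
Lemma size_adj_char_poly_mx (F : idomainType) n (A : 'M[F]_n) i j :
  (size (\adj (char_poly_mx A) i j) <= n)%N.
Proof.
rewrite !mxE /cofactor -signr_odd mulr_sign; set d := \det _.
have -> : size (if odd (j + i) then - d else d) = size d.
  by case: ifP; rewrite ?size_polyN.
rewrite {}/d; case: n => [|n] in A i j *; first by case: i.
apply: size_det_leq => k l; rewrite !mxE.
apply: (leq_trans (size_polyD _ _)); rewrite size_polyN geq_max.
apply/andP; split.
  by case: eqP => _; rewrite ?mulr1n ?mulr0n ?size_polyX ?size_poly0.
by apply: leq_trans (size_polyC_leq1 _) _.
Qed.

(** * Transfer matrices and their Markov parameters *)

HB.instance Definition _ (R : realType) :=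
  GRing.isZmodMorphism.Build R {fraction {poly R}} (@constF R)
    (fun x y => rmorphB (@tofrac {poly R} \o @polyC R) x y).

HB.instance Definition _ (R : realType) :=
  GRing.isMonoidMorphism.Build R {fraction {poly R}} (@constF R)
    (rmorph1 (@tofrac {poly R} \o @polyC R),
     fun x y => rmorphM (@tofrac {poly R} \o @polyC R) x y).

Section Transfer.
Variables (R : realType).

Lemma indet_sub_map n (A : 'M[R]_n) :
  indet%:M - map_mx (@constF R) A = map_mx (@tofrac {poly R}) (char_poly_mx A).
Proof. by rewrite /char_poly_mx map_mxB map_scalar_mx -map_mx_comp. Qed.

Lemma det_indet_sub_map n (A : 'M[R]_n) :
  \det (indet%:M - map_mx (@constF R) A) = tofrac (char_poly A).
Proof. by rewrite indet_sub_map det_map_mx. Qed.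

Lemma indet_sub_map_unitmx n (A : 'M[R]_n) :
  indet%:M - map_mx (@constF R) A \in unitmx.
Proof.
rewrite unitmxE det_indet_sub_map unitfE tofrac_eq0.
exact: monic_neq0 (char_poly_monic A).
Qed.

Lemma strictly_proper_resolvent n (A : 'M[R]_n) i j :
  strictly_proper (invmx (indet%:M - map_mx (@constF R) A) i j).
Proof.
rewrite /invmx indet_sub_map_unitmx mxE det_indet_sub_map indet_sub_map.
rewrite -map_mx_adj mxE mulrC.
exists (\adj (char_poly_mx A) i j), (char_poly A); split=> //.
  exact: monic_neq0 (char_poly_monic A).
by rewrite size_char_poly ltnS size_adj_char_poly_mx.
Qed.

Lemma strictly_proper_transfer0 n m (A : 'M[R]_n) (B : 'M[R]_(n, m))
    (C : 'M[R]_(m, n)) i j :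
  strictly_proper (transfer A B C 0 indet i j).
Proof.
rewrite /transfer map_mx0 addr0 !mxE; apply: strictly_proper_sum => k.
rewrite [X in X * _]mxE [X in _ * X]mxE mulrC; apply: strictly_properZ.
apply: strictly_proper_sum => l; rewrite mxE.
exact/strictly_properZ/strictly_proper_resolvent.
Qed.

Lemma transferD n m (A : 'M[R]_n) (B : 'M[R]_(n, m)) (C : 'M[R]_(m, n))
    (D : 'M[R]_m) z :
  transfer A B C D z = transfer A B C 0 z + map_mx (@constF R) D.
Proof. by rewrite /transfer map_mx0 addr0. Qed.

(** From [(sI - A) X = I] follows [s X = I + A X]: multiplication by [s] promotes the Markov
    parameter [C B] to the feedthrough and shifts the others. *)
Lemma indet_transfer n m (A : 'M[R]_n) (B : 'M[R]_(n, m)) (C : 'M[R]_(m, n)) :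
  indet *: transfer A B C 0 indet = transfer A B (C *m A) (C *m B) indet.
Proof.
rewrite [RHS]transferD /transfer map_mx0 !addr0 !map_mxM.
have := mulmxV (indet_sub_map_unitmx A); set X := invmx _ => eqX.
have sX : indet *: X = 1%:M + map_mx (@constF R) A *m X.
  by rewrite -eqX mulmxBl mul_scalar_mx subrK.
by rewrite scalemxAl scalemxAr sX mulmxDr mulmxDl mulmx1 addrC mulmxA.
Qed.

(** The difference of the feedthroughs is constant and strictly proper, hence zero; [indet_transfer]
    then brings each Markov parameter in turn into the feedthrough position. *)
Lemma transfer_inj n1 n2 m (A1 : 'M[R]_n1) (B1 : 'M[R]_(n1, m))
    (C1 : 'M[R]_(m, n1)) (D1 : 'M[R]_m) (A2 : 'M[R]_n2)
    (B2 : 'M[R]_(n2, m)) (C2 : 'M[R]_(m, n2)) (D2 : 'M[R]_m) :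
  transfer A1 B1 C1 D1 indet = transfer A2 B2 C2 D2 indet ->
  D1 = D2 /\ forall k, C1 *m A1 ^+ k *m B1 = C2 *m A2 ^+ k *m B2.
Proof.
(* The output matrices stay arbitrary because the induction replaces [C] by [C A]. *)
have base (E1 : 'M[R]_(m, n1)) (E2 : 'M[R]_(m, n2)) F1 F2 :
    transfer A1 B1 E1 F1 indet = transfer A2 B2 E2 F2 indet -> F1 = F2.
  move=> /matrixP eqT; apply/matrixP => i j; apply/eqP; rewrite -subr_eq0.
  apply/eqP/strictly_proper_const; rewrite -/(constF _) rmorphB /=.
  have := eqT i j; rewrite transferD [in RHS]transferD.
  rewrite mxE [in RHS]mxE ![(map_mx _ _) _ _]mxE => eqij.
  have -> : constF (F1 i j) - constF (F2 i j) =
      transfer A2 B2 E2 0 indet i j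
      + constF (-1) * transfer A1 B1 E1 0 indet i j.
    rewrite rmorphN1 mulN1r; apply/eqP; rewrite subr_eq addrAC eq_sym subr_eq.
    by rewrite -eqij addrC.
  apply: strictly_properD; first exact: strictly_proper_transfer0.
  exact/strictly_properZ/strictly_proper_transfer0.
move=> eqT; split; first exact: base eqT.
have {eqT} : transfer A1 B1 C1 0 indet = transfer A2 B2 C2 0 indet.
  have eqD := base _ _ _ _ eqT; move: eqT.
  by rewrite transferD [in RHS]transferD eqD => /addIr.
move=> + k; elim: k C1 C2 => [|k IHk] E1 E2 eqT.
  rewrite !expr0 !mulmx1; apply: base (E1 *m A1) (E2 *m A2) _ _ _.
  by rewrite -!indet_transfer eqT.
rewrite !exprS -!mulmxE !(mulmxA E1) !(mulmxA E2); apply: IHk.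
have eqAB : transfer A1 B1 (E1 *m A1) (E1 *m B1) indet
    = transfer A2 B2 (E2 *m A2) (E2 *m B2) indet.
  by rewrite -!indet_transfer eqT.
have eqB := base _ _ _ _ eqAB; move: eqAB.
by rewrite transferD [in RHS]transferD eqB => /addIr.
Qed.

Lemma transfer_tr n m (A : 'M[R]_n) (B : 'M[R]_(n, m)) (C : 'M[R]_(m, n))
    (D : 'M[R]_m) z :
  (transfer A B C D z)^T = transfer A^T C^T B^T D^T z.
Proof.
rewrite /transfer linearD /= !trmx_mul trmx_inv linearB /= tr_scalar_mx.
by rewrite !map_trmx mulmxA.
Qed.

(** Since [-sI - A = -(sI - (-A))], the sign leaves the inverse and cancels the outer one. Signed
    time-reversibility thereby becomes an equality to which [transfer_inj] applies. *)
Lemma transferN n m (A : 'M[R]_n) (B : 'M[R]_(n, m)) (C : 'M[R]_(m, n))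
    (D : 'M[R]_m) :
  - transfer A B C D (- indet) = transfer (- A) B C (- D) indet.
Proof.
rewrite /transfer opprD !map_mxN; congr (_ + _).
rewrite -mulNmx -mulmxN; congr (_ *m _ *m _).
have -> : (- indet)%:M - map_mx (@constF R) A
    = (-1) *: (indet%:M - map_mx (@constF R) (- A)).
  by rewrite scaleN1r map_mxN opprK raddfN /= opprD.
rewrite invmxZ ?unitmxZ ?unitrN1 ?indet_sub_map_unitmx //.
by rewrite invrN1 scaleN1r opprK map_mxN.
Qed.

End Transfer.

(** * Derivatives of matrix-valued functions *)

Section MatrixDerive.
Variable R : realType.

Lemma is_derive_mxP m n (f : R -> 'M[R]_(m, n)) t (l : 'M[R]_(m, n)) :
  is_derive t (1 : R) f l <->
  forall i j, is_derive t (1 : R) (fun x => f x i j) (l i j).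
Proof.
split=> [[df dfE] i j|df].
  split; first exact: (derivable_mxP f t 1).1.
  by rewrite -dfE derive_mx // mxE.
have df' : derivable f t 1 by apply/derivable_mxP => i j; have [] := df i j.
split=> //; rewrite derive_mx //; apply/matrixP => i j; rewrite mxE.
by have [] := df i j.
Qed.

Lemma is_derive_mulmx m n p (f : R -> 'M[R]_(m, n)) (g : R -> 'M[R]_(n, p))
    t (f' : 'M[R]_(m, n)) (g' : 'M[R]_(n, p)) :
  is_derive t (1 : R) f f' -> is_derive t (1 : R) g g' ->
  is_derive t (1 : R) (fun x => f x *m g x) (f' *m g t + f t *m g').
Proof.
move=> /is_derive_mxP df /is_derive_mxP dg; apply/is_derive_mxP => i j.
have -> : (fun x => (f x *m g x) i j)
    = \sum_k ((fun x => f x i k) * (fun x => g x k j)).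
  by apply/funext => x; rewrite mxE fct_sumE.
apply: is_derive_eq (is_derive_sum (fun k => is_deriveM (df i k) (dg k j))) _.
rewrite !mxE -big_split; apply: eq_bigr => k _ /=.
by rewrite addrC; congr (_ + _); exact: mulrC.
Qed.

Lemma is_derive_trmx m n (f : R -> 'M[R]_(m, n)) t (l : 'M[R]_(m, n)) :
  is_derive t (1 : R) f l -> is_derive t (1 : R) (fun x => (f x)^T) l^T.
Proof.
move=> /is_derive_mxP df; apply/is_derive_mxP => i j; rewrite mxE.
by under eq_fun do rewrite mxE; exact: df.
Qed.

End MatrixDerive.

(** * The flow of a linear differential equation by power series *)

Section LinearODE.
Variables (R : realType) (n : nat) (M : 'M[R]_n).
Implicit Types z : 'cV[R]_n.

(** Coefficient of [t^k] in entry [i] of [exp(tM) z]; working entrywise gives access to scalar power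
    series. *)
Definition expm_coeff z i (k : nat) : R := (M ^+ k *m z) i 0 / k`!%:R.

(** The sum of all [|M i j|] bounds every row sum, so each multiplication by [M] costs at most that
    factor. *)
Lemma expm_coeff_bound z i k :
  `|expm_coeff z i k|
    <= (\sum_i `|z i 0|) * exp_coeff (\sum_i \sum_j `|M i j|) k.
Proof.
rewrite /expm_coeff /exp_coeff /= normrM normfV normr_nat mulrA.
apply: ler_wpM2r; first by rewrite invr_ge0.
elim: k i => [|k IHk] i.
  rewrite expr0 mul1mx mulr1 (bigD1 i) //= lerDl; exact: sumr_ge0.
rewrite exprS -mulmxE -mulmxA mxE; apply: le_trans (ler_norm_sum _ _ _) _.
rewrite exprS mulrCA mulr_suml [leRHS](bigD1 i) //= ler_wpDr //.
  apply: sumr_ge0 => j _; rewrite !mulr_ge0 ?sumr_ge0 // exprn_ge0 //.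
  by apply: sumr_ge0 => l _; exact: sumr_ge0.
rewrite mulr_suml; apply: ler_sum => j _; rewrite normrM.
exact: ler_wpM2l.
Qed.

Lemma is_cvg_expm_coeff z i x : cvgn (pseries (expm_coeff z i) x).
Proof.
apply: normed_cvg.
set b := \sum_i `|z i 0|; set c := \sum_i \sum_j `|M i j|.
have c0 : 0 <= c by apply: sumr_ge0 => k _; exact: sumr_ge0.
have b0 : 0 <= b by exact: sumr_ge0.
apply: (@series_le_cvg _ _ (b *: exp_coeff (c * `|x|))) => [k|k|k|] //=.
- by rewrite mulr_ge0 // exp_coeff_ge0 // mulr_ge0.
- rewrite normrM normrX.
  apply: le_trans (ler_wpM2r _ (expm_coeff_bound z i k)) _.
    exact: exprn_ge0.
  rewrite -[leRHS]/(b * ((c * `|x|) ^+ k / k`!%:R)) exprMn -/b -/c.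
  by rewrite /exp_coeff /= -mulrA [_ / _ * _]mulrAC.
- exact/is_cvg_seriesZ/is_cvg_series_exp_coeff.
Qed.

(* Term-by-term differentiation only replaces the initial value z by M z,
   which makes all convergence conditions of [pseries_snd_diffs] instances of
   [is_cvg_expm_coeff]. *)
Lemma pseries_diffs_expm_coeff z i :
  pseries_diffs (expm_coeff z i) = expm_coeff (M *m z) i.
Proof.
apply/funext => k; rewrite /pseries_diffs /expm_coeff mulmxA exprSr factS natrM.
by rewrite invfM mulrCA mulVKf.
Qed.

Definition expm_flow z (t : R) : 'cV[R]_n :=
  \col_i limn (pseries (expm_coeff z i) t).

Lemma expm_flow0 z : expm_flow z 0 = z.
Proof.
apply/matrixP => i j; rewrite ord1 mxE; apply/cvg_lim => //.
(* The partial sum of index 0 is empty; all later ones equal [z i 0]. *)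
rewrite -(cvg_shiftS (pseries (expm_coeff z i) 0)).
rewrite (_ : (fun _ => _) = cst (z i 0)); first exact: cvg_cst.
apply/funext => k; rewrite /pseries /series /= big_nat_recl //= big1.
  by rewrite /expm_coeff expr0 mulr1 fact0 divr1 mul1mx addr0.
by move=> l _; rewrite expr0n mulr0.
Qed.

Lemma expm_flow_mul z t : expm_flow (M *m z) t = M *m expm_flow z t.
Proof.
apply/matrixP => i j; rewrite !mxE; apply/cvg_lim => //.
under eq_bigr do rewrite mxE.
rewrite (_ : pseries _ t =
    fun k => \sum_j M i j * pseries (expm_coeff z j) t k); last first.
  apply/funext => k; rewrite /pseries /series /=.
  under eq_bigr => l _.
    rewrite /expm_coeff mulmxA mulmxE -exprSr exprS -mulmxE -mulmxA mxE.
    rewrite !mulr_suml; over.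
  rewrite exchange_big; apply: eq_bigr => l _; rewrite mulr_sumr.
  by apply: eq_bigr => q _; rewrite !mulrA.
apply: cvg_big => [|l _]; first exact: add_continuous.
apply: cvgMl_tmp; exact: is_cvg_expm_coeff.
Qed.

Lemma is_derive_expm_flow z t :
  is_derive t (1 : R) (expm_flow z) (M *m expm_flow z t).
Proof.
rewrite -expm_flow_mul; apply/is_derive_mxP => i j; rewrite mxE.
under eq_fun do rewrite mxE.
rewrite -pseries_diffs_expm_coeff.
(* Any radius above [|t|] serves, since the series converge everywhere. *)
apply: (@pseries_snd_diffs _ _ (`|t| + 1)).
- exact: is_cvg_expm_coeff.
- rewrite pseries_diffs_expm_coeff; exact: is_cvg_expm_coeff.
- rewrite !pseries_diffs_expm_coeff; exact: is_cvg_expm_coeff.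
- by rewrite [ltRHS]ger0_norm ?addr_ge0 // ltrDl.
Qed.

End LinearODE.

(** * Storage matrices as solutions of matrix equations *)

Lemma is_derive_stored_energy (R : realType) n (Q : 'M[R]_n)
    (x : R -> 'cV[R]_n) (x' : 'cV[R]_n) t :
  Q^T = Q -> is_derive t (1 : R) x x' ->
  is_derive t (1 : R) (fun s => stored_energy Q (x s))
    (((x t)^T *m Q *m x') 0 0).
Proof.
move=> Qsym dx.
have dQ : is_derive t (1 : R) (fun=> Q) 0 by exact: is_derive_cst.
have /is_derive_mxP/(_ 0 0) dq :=
  is_derive_mulmx (is_derive_mulmx (is_derive_trmx dx) dQ) dx.
apply: is_derive_eq (is_deriveZ 2^-1 dq) _.
(* Symmetry of [Q] makes the two terms of the product rule equal scalars; the factor 1/2 removes the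
   doubling. *)
have swap : x'^T *m Q *m x t = ((x t)^T *m Q *m x')^T.
  by rewrite !trmx_mul Qsym trmxK mulmxA.
rewrite mulmx0 addr0 mxE swap mxE -mulr2n -[_ *: _]/(_ * _).
by rewrite -[X in _ * X]mulr_natl mulrA mulVf ?mul1r // pnatr_eq0.
Qed.

Lemma trmx11 (T : Type) (M : 'M[T]_1) : M^T = M.
Proof. by apply/matrixP => i j; rewrite mxE !ord1. Qed.

Lemma bilinear_form_inj (R : pzRingType) n m (S T : 'M[R]_(n, m)) :
  (forall (u : 'cV_n) (v : 'cV_m),
     (u^T *m S *m v) 0 0 = (u^T *m T *m v) 0 0) -> S = T.
Proof.
move=> eqST; apply/matrixP => i j.
have := eqST (delta_mx i 0) (delta_mx j 0).
by rewrite trmx_delta -!rowE -!colE !mxE.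
Qed.

(** Forward, polarization at [u + v]; backward, the value of the form equals its own opposite. *)
Lemma quadratic_form_eq0 (R : numDomainType) n (S : 'M[R]_n) :
  (forall v : 'cV[R]_n, (v^T *m S *m v) 0 0 = 0) <-> S + S^T = 0.
Proof.
have swap (u v : 'cV[R]_n) : u^T *m S^T *m v = v^T *m S *m u.
  by rewrite -[RHS]trmx11 !trmx_mul trmxK mulmxA.
split=> [S0|/eqP SS v].
  apply: bilinear_form_inj => u v; rewrite mulmx0 mul0mx mulmxDr mulmxDl swap.
  have DE (M N : 'M[R]_1) : (M + N) 0 0 = M 0 0 + N 0 0 by rewrite mxE.
  have := S0 (u + v); rewrite [(u + v)^T]linearD /= !mulmxDl !mulmxDr !DE.
  by rewrite !S0 add0r addr0 => ->; rewrite mxE.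
have := swap v v; rewrite addrC addr_eq0 in SS; rewrite (eqP SS) mulmxN mulNmx.
move=> /matrixP/(_ 0 0)/eqP; rewrite mxE -subr_eq0 -opprD oppr_eq0 -mulr2n.
by rewrite mulrn_eq0 => /eqP.
Qed.

Lemma storage_matrixP (R : realType) n m (A : 'M[R]_n) (B : 'M[R]_(n, m))
    (C : 'M[R]_(m, n)) (D : 'M[R]_m) (Q : 'M[R]_n) :
  storage_matrix A B C D Q <->
  [/\ Q^T = Q, A^T *m Q + Q *m A = 0, B^T *m Q = C & D + D^T = 0].
Proof.
split=> [[Qsym stored]|[Qsym QA QB DD]].
  (* The derivative of the stored energy at time 0 is computed in two ways, along a trajectory with
     arbitrary initial state and input. *)
  have power (x0 : 'cV[R]_n) (u0 : 'cV[R]_m) :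
      (x0^T *m Q *m (A *m x0 + B *m u0)) 0 0
      = ((C *m x0 + D *m u0)^T *m u0) 0 0.
    (* The zero lower blocks keep the input constant. *)
    pose z := expm_flow (block_mx A B 0 0) (col_mx x0 u0).
    pose x t := usubmx (z t); pose u t := dsubmx (z t).
    have traj : trajectory A B C D u x (fun t => C *m x t + D *m u t).
      split=> // t; have /is_derive_mxP dz :=
        is_derive_expm_flow (block_mx A B 0 0) (col_mx x0 u0) t.
      apply/is_derive_mxP => i j.
      have := dz (lshift m i) j; rewrite -/(z t) -[z t]vsubmxK mul_block_col.
      rewrite col_mxEu => dzi; under eq_fun do rewrite mxE; exact: dzi.
    have x0E : x 0 = x0 by rewrite /x /z expm_flow0 col_mxKu.
    have u0E : u 0 = u0 by rewrite /u /z expm_flow0 col_mxKd.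
    have [_ dE] := is_derive_stored_energy Qsym (traj.1 0).
    have [_] := stored _ _ _ traj 0.
    by rewrite dE /supply x0E u0E.
  (* Zero input isolates the form of [Q A], zero state that of [D]; what then remains of [power] is
     bilinear in state and input. *)
  have xQAx (x0 : 'cV_n) : (x0^T *m (Q *m A) *m x0) 0 0 = 0.
    by have := power x0 0; rewrite !mulmx0 addr0 !mulmxA => ->; rewrite mxE.
  have uDu (u0 : 'cV_m) : (u0^T *m D^T *m u0) 0 0 = 0.
    have := power 0 u0; rewrite trmx0 !mul0mx mulmx0 add0r trmx_mul => <-.
    by rewrite mxE.
  split=> //.
  - have /quadratic_form_eq0 := xQAx.
    by rewrite trmx_mul Qsym addrC.
  - apply: trmx_inj; rewrite trmx_mul trmxK Qsym.
    apply: bilinear_form_inj => x0 u0; have := power x0 u0.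
    rewrite [(_ + _)^T]linearD /= !trmx_mul mulmxDr !mulmxDl !mulmxA.
    rewrite mxE -(mulmxA _ Q A) xQAx add0r => ->.
    by rewrite mxE uDu addr0.
  - have /quadratic_form_eq0 := uDu.
    by rewrite trmxK addrC.
split=> // u x y [dx yE] t.
apply: is_derive_eq (is_derive_stored_energy Qsym (dx t)) _.
have xQAx : ((x t)^T *m (Q *m A) *m x t) 0 0 = 0.
  by apply: (quadratic_form_eq0 _).2; rewrite trmx_mul Qsym addrC.
have uDu : ((u t)^T *m D^T *m u t) 0 0 = 0.
  by apply: (quadratic_form_eq0 _).2; rewrite trmxK addrC.
have {}QB : Q *m B = C^T by rewrite -QB trmx_mul trmxK Qsym.
rewrite /supply yE [(_ + _)^T]linearD /= !trmx_mul mulmxDr !mulmxDl !mulmxA.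
rewrite [LHS]mxE [RHS]mxE uDu addr0 -[X in X *m x t]mulmxA xQAx add0r.
by rewrite -[X in X *m u t]mulmxA QB.
Qed.

(** * Signed time-reversibility maps and the two implications *)

Lemma reversibility_map_transfer (R : realType) n m (A T : 'M[R]_n)
    (B : 'M[R]_(n, m)) (C : 'M[R]_(m, n)) :
  signed_time_reversibility_map A B C T -> signed_time_reversible A B C 0.
Proof.
move=> [_ TA TB CT]; rewrite /signed_time_reversible transferN oppr0 /transfer.
have := mulVmx (indet_sub_map_unitmx (- A)).
have := mulVmx (indet_sub_map_unitmx A).
set X := invmx (_ - map_mx _ A); set Y := invmx (_ - map_mx _ (- A)).
(* Without this, conversion checks unfold the inverses and do not end. *)
clearbody X Y => /mulmx1C VX YV; congr (_ + _).
(* As [(sI + A) T = T (sI - A)], the map [T] intertwines the resolvents, and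
   [C Y B = C Y T B = C T X B = C X B]. *)
have TX : Y *m map_mx (@constF R) T = map_mx (@constF R) T *m X.
  rewrite -[LHS]mulmx1 -VX mulmxA -(mulmxA Y); congr (_ *m _).
  rewrite -[RHS]mul1mx -YV -mulmxA; congr (_ *m _).
  rewrite mulmxBr mulmxBl -!map_mxM TA mulNmx.
  by rewrite mul_mx_scalar mul_scalar_mx.
rewrite -[in RHS]TB map_mxM (mulmxA _ (map_mx _ T)) -(mulmxA _ Y) TX.
by rewrite mulmxA -map_mxM -CT.
Qed.

Lemma reversibility_map_involutive (R : realType) n m (A T : 'M[R]_n)
    (B : 'M[R]_(n, m)) (C : 'M[R]_(m, n)) :
  controllable A B -> signed_time_reversibility_map A B C T -> T *m T = 1%:M.
Proof.
move=> ctrl [_ TA TB _]; apply: (controllable_inj ctrl) => k.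
have TAk (j : nat) : T *m (A ^+ j *m B) = (-1) ^+ j *: (A ^+ j *m B).
  elim: j => [|j IHj]; first by rewrite !expr0 mul1mx scale1r.
  rewrite exprS -mulmxE -mulmxA (mulmxA T) TA mulNmx -mulmxA IHj.
  by rewrite -scalemxAr mulmxA exprS mulN1r scaleNr.
by rewrite mul1mx -mulmxA TAk -scalemxAr TAk scalerA -expr2 sqrr_sign scale1r.
Qed.

Lemma trmx_exp (R : comPzRingType) n (A : 'M[R]_n) k : (A ^+ k)^T = A^T ^+ k.
Proof.
elim: k => [|k IHk]; first by rewrite !expr0 trmx1.
by rewrite exprS exprSr -!mulmxE trmx_mul IHk.
Qed.

Lemma exprNmx (R : comPzRingType) n (A : 'M[R]_n) k :
  (- A) ^+ k = (-1) ^+ k *: A ^+ k.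
Proof.
elim: k => [|k IHk]; first by rewrite !expr0 scale1r.
by rewrite !exprS IHk -!mulmxE mulNmx -scalemxAr mulN1r scaleNr.
Qed.

Theorem proposition6 (R : realType) (n m : nat)
    (A : 'M[R]_n) (B : 'M[R]_(n, m)) (C : 'M[R]_(m, n)) (D : 'M[R]_m)
    (Smin : minimal A B C) :
  (reciprocal A B C D -> signed_time_reversible A B C D ->
     cyclo_lossless A B C D) /\
  (forall Q G : 'M[R]_n,
     storage_matrix A B C D Q -> Q \in unitmx ->
     reciprocal A B C D -> pseudo_inner_product A B C D G ->
     [/\ D = 0,
         Q = G *m invmx Q *m G,
         signed_time_reversible A B C D
       & signed_time_reversibility_map A B C (invmx Q *m G)]).
Proof.
have [ctrl _] := Smin; split.
  (* The two hypotheses compare the system with [(A^T, C^T, B^T, D^T)] and with [(-A, B, C, -D)]. *)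
  rewrite /reciprocal /signed_time_reversible transfer_tr transferN.
  move=> /transfer_inj[DT markov_sym] /transfer_inj[DN markov_sign].
  have [||Q [Qsym QA QB]] := @signed_symmetric_markov_form R n m A B C ctrl.
  - by move=> k; rewrite [LHS]markov_sym !trmx_mul trmx_exp mulmxA.
  - move=> k; rewrite [LHS]markov_sign.
    by rewrite exprNmx -scalemxAr -scalemxAl.
  exists Q; apply/storage_matrixP; split=> //.
  by rewrite -DT {1}DN addNr.
move=> Q G /storage_matrixP[Qsym QA QB DD] Qunit _ [Gunit Gsym GA GB DT].
have D0 : D = 0.
  move/eqP: DD; rewrite -DT -mulr2n -scaler_nat scaler_eq0 pnatr_eq0.
  by move=> /eqP.
have map_QG : signed_time_reversibility_map A B C (invmx Q *m G).
  split.
  - by rewrite unitmx_mul unitmx_inv Qunit.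
  (* After multiplication by [Q] both sides are [A^T G], because [Q A = -A^T Q]. *)
  - rewrite -mulmxA -GA.
    apply: (can_inj (mulKmx Qunit)); rewrite mulKVmx // mulmxN mulmxA.
    move/eqP: QA; rewrite addrC addr_eq0 => /eqP ->.
    by rewrite mulNmx opprK -!mulmxA mulKVmx.
  - apply: (can_inj (mulKmx Qunit)); rewrite -mulmxA mulKVmx //.
    by apply: trmx_inj; rewrite !trmx_mul Gsym Qsym GB QB.
  - by rewrite -{2}QB -mulmxA mulKVmx // GB.
split=> //.
  (* Multiplying [T T = I] on the left by [Q], with [T = Q^-1 G], gives [G Q^-1 G = Q]. *)
  have /(congr1 (mulmx Q)) := reversibility_map_involutive ctrl map_QG.
  by rewrite !mulmxA mulmxV // mul1mx mulmx1.
by rewrite D0; exact: reversibility_map_transfer map_QG.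
Qed.
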